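(* Let $R$ be a Noetherian commutative ring. Let $M$ be an $R$-module and let $\{M_i\}$ be the set of finitely generated submodules of $M$ (directed by inclusion). Then $M$ is a flat $R$-module if and only if $$M\otimes_RN=\varinjlim_i\mathrm{Hom}_R(M_i^*,N)$$ for every $R$-module $N$ (that is, the natural morphism $M\otimes_RN=\varinjlim_i(M_i\otimes_RN)\to\varinjlim_i\mathrm{Hom}_R(M_i^*,N)$ is an isomorphism for every $N$).
   Context: $M_i^*:=\mathrm{Hom}_R(M_i,R)$. For $M_i\subseteq M_j$ the transition morphism $\mathrm{Hom}_R(M_i^*,N)\to\mathrm{Hom}_R(M_j^*,N)$ is induced by the restriction map $M_j^*\to M_i^*$. The natural morphism $M_i\otimes_RN\to\mathrm{Hom}_R(M_i^*,N)$ is $m\otimes n\mapsto(w\mapsto w(m)n)$. *)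

(* Defs.v *)
From HB Require Import structures.
From mathcomp Require Import all_boot all_order all_algebra.
From mathcomp Require Import generic_quotient.
From mathcomp Require Import boolp.

Set Implicit Arguments.
Unset Strict Implicit.
Unset Printing Implicit Defensive.

Import GRing.Theory.

Local Open Scope ring_scope.
Local Open Scope quotient_scope.

(* Rings are [comPzRingType], so that the zero ring is allowed. *)

Section MkLinear.
Context (R : pzRingType) (U V : lmodType R).

Definition mklin (f : U -> V) (fl : linear f) : {linear U -> V} :=
  HB.pack_for {linear U -> V} f (GRing.isLinear.Build R U V *:%R f fl).

Lemma mklinE f fl : @mklin f fl =1 f. Proof. by []. Qed.

Lemma linear_ext (f g : {linear U -> V}) : f =1 g -> f = g.
Proof.
move=> /funext; case: f g => f [[f1] [f2]] [g [[g1] [g2]]] /= fg.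
case: g / fg g1 g2 => g1 g2.
by congr (GRing.Linear.Pack (GRing.Linear.Class _ _));
  [congr GRing.isNmodMorphism.Axioms_ | congr GRing.isScalable.Axioms_];
  exact: Prop_irrelevance.
Qed.
End MkLinear.

(* The R-module Hom_R(U, V), carried by {linear U -> V}. *)
Section HomModule.
Context (R : comPzRingType) (U V : lmodType R).
Implicit Types (f g h : {linear U -> V}) (a b : R).

Fact hom_zero_subproof : linear (fun _ : U => 0 : V).
Proof. by move=> a x y; rewrite scaler0 addr0. Qed.
Fact hom_add_subproof f g : linear (fun x => f x + g x).
Proof. by move=> a x y; rewrite !linearP scalerDr addrACA. Qed.
Fact hom_opp_subproof f : linear (fun x => - f x).
Proof. by move=> a x y; rewrite linearP opprD scalerN. Qed.
Fact hom_scale_subproof b f : linear (fun x => b *: f x).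
Proof. by move=> a x y; rewrite linearP scalerDr !scalerA mulrC. Qed.

Definition hom_zero := mklin hom_zero_subproof.
Definition hom_add f g := mklin (hom_add_subproof f g).
Definition hom_opp f := mklin (hom_opp_subproof f).
Definition hom_scale b f := mklin (hom_scale_subproof b f).

HB.instance Definition _ := gen_eqMixin {linear U -> V}.
HB.instance Definition _ := gen_choiceMixin {linear U -> V}.

Fact hom_addA : associative hom_add.
Proof. by move=> f g h; apply: linear_ext => x /=; rewrite addrA. Qed.
Fact hom_addC : commutative hom_add.
Proof. by move=> f g; apply: linear_ext => x /=; rewrite addrC. Qed.
Fact hom_add0 : left_id hom_zero hom_add.
Proof. by move=> f; apply: linear_ext => x /=; rewrite add0r. Qed.
Fact hom_addN : left_inverse hom_zero hom_opp hom_add.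
Proof. by move=> f; apply: linear_ext => x /=; rewrite addNr. Qed.

HB.instance Definition _ :=
  GRing.isZmodule.Build {linear U -> V} hom_addA hom_addC hom_add0 hom_addN.

Fact hom_scaleA a b f : hom_scale a (hom_scale b f) = hom_scale (a * b) f.
Proof. by apply: linear_ext => x /=; rewrite scalerA. Qed.
Fact hom_scale1 : left_id 1 hom_scale.
Proof. by move=> f; apply: linear_ext => x /=; rewrite scale1r. Qed.
Fact hom_scaleDr : right_distributive hom_scale +%R.
Proof. by move=> a f g; apply: linear_ext => x /=; rewrite scalerDr. Qed.
Fact hom_scaleDl f : {morph hom_scale^~ f : a b / a + b}.
Proof. by move=> a b; apply: linear_ext => x /=; rewrite scalerDl. Qed.

HB.instance Definition _ := GRing.Zmodule_isLmodule.Build R {linear U -> V}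
  hom_scaleA hom_scale1 hom_scaleDr hom_scaleDl.

Lemma homDE f g x : (f + g) x = f x + g x. Proof. by []. Qed.
Lemma homZE a f x : (a *: f) x = a *: f x. Proof. by []. Qed.
Lemma hom0E x : (0 : {linear U -> V}) x = 0. Proof. by []. Qed.
End HomModule.

(* The tensor product: formal sums of pairs modulo the congruence generated *)
(* by the bilinearity relations. -1 acts on pairs, whence the opposites.    *)
Section Tensor.
Context (R : comPzRingType) (M N : lmodType R).

Inductive tensor_rel : seq (M * N) -> seq (M * N) -> Prop :=
| tensor_refl s : tensor_rel s s
| tensor_sym s t : tensor_rel s t -> tensor_rel t s
| tensor_trans s t u : tensor_rel s t -> tensor_rel t u -> tensor_rel s u
| tensor_cat s t s' t' :
    tensor_rel s t -> tensor_rel s' t' -> tensor_rel (s ++ s') (t ++ t')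
| tensor_catC s t : tensor_rel (s ++ t) (t ++ s)
| tensor_0l n : tensor_rel [:: (0, n)] [::]
| tensor_Dl m m' n : tensor_rel [:: (m + m', n)] [:: (m, n); (m', n)]
| tensor_Dr m n n' : tensor_rel [:: (m, n + n')] [:: (m, n); (m, n')]
| tensor_Z a m n : tensor_rel [:: (a *: m, n)] [:: (m, a *: n)].

Definition tensor_relb s t := `[< tensor_rel s t >].

Fact tensor_relb_refl : reflexive tensor_relb.
Proof. by move=> s; apply/asboolP/tensor_refl. Qed.
Fact tensor_relb_sym : symmetric tensor_relb.
Proof. by move=> s t; apply/asboolP/asboolP => /tensor_sym. Qed.
Fact tensor_relb_trans : transitive tensor_relb.
Proof.
move=> t s u /asboolP st /asboolP tu; apply/asboolP; exact: tensor_trans st tu.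
Qed.

Canonical tensor_equiv :=
  EquivRel tensor_relb tensor_relb_refl tensor_relb_sym tensor_relb_trans.

Definition tensor := {eq_quot tensor_equiv}.

HB.instance Definition _ := Choice.on tensor.
HB.instance Definition _ := EqQuotient.on tensor.

Lemma tensor_piP s t : tensor_rel s t <-> \pi_tensor s = \pi_tensor t.
Proof.
split=> [st|/eqmodP/asboolP//]; exact/eqmodP/asboolP.
Qed.

Lemma tensor_reprP s : tensor_rel (repr (\pi_tensor s)) s.
Proof. by apply/tensor_piP; rewrite reprK. Qed.

Definition pure (m : M) (n : N) : tensor := \pi_tensor [:: (m, n)].

Definition scale_pairs (a : R) (s : seq (M * N)) :=
  [seq (a *: p.1, p.2) | p <- s].

Lemma scale_pairs_rel a s t :
  tensor_rel s t -> tensor_rel (scale_pairs a s) (scale_pairs a t).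
Proof.
elim=> {s t}.
- by move=> s; exact: tensor_refl.
- by move=> s t _; exact: tensor_sym.
- by move=> s t u _ st _; exact: tensor_trans.
- move=> s t s' t' _ st _ st'; rewrite /scale_pairs !map_cat; exact: tensor_cat.
- move=> s t; rewrite /scale_pairs !map_cat; exact: tensor_catC.
- move=> n /=; rewrite scaler0; exact: tensor_0l.
- move=> m m' n /=; rewrite scalerDr; exact: tensor_Dl.
- move=> m n n' /=; exact: tensor_Dr.
- move=> b m n /=; rewrite scalerA mulrC -scalerA; exact: tensor_Z.
Qed.

Definition tensor_zero : tensor := \pi_tensor [::].
Definition tensor_add (x y : tensor) : tensor := \pi_tensor (repr x ++ repr y).
Definition tensor_scale (a : R) (x : tensor) : tensor :=
  \pi_tensor (scale_pairs a (repr x)).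
Definition tensor_opp (x : tensor) : tensor := tensor_scale (-1) x.

Lemma tensor_addE s t :
  tensor_add (\pi_tensor s) (\pi_tensor t) = \pi_tensor (s ++ t).
Proof. apply/tensor_piP/tensor_cat; exact: tensor_reprP. Qed.

Lemma tensor_scaleE a s :
  tensor_scale a (\pi_tensor s) = \pi_tensor (scale_pairs a s).
Proof. by apply/tensor_piP/scale_pairs_rel/tensor_reprP. Qed.

Fact tensor_addA : associative tensor_add.
Proof.
elim/quotW=> s; elim/quotW=> t; elim/quotW=> u.
by rewrite (tensor_addE t u) (tensor_addE s t) !tensor_addE catA.
Qed.
Fact tensor_addC : commutative tensor_add.
Proof.
elim/quotW=> s; elim/quotW=> t; rewrite !tensor_addE.
exact/tensor_piP/tensor_catC.
Qed.
Fact tensor_add0 : left_id tensor_zero tensor_add.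
Proof. by elim/quotW=> s; rewrite tensor_addE. Qed.

Lemma scale_pairsDl a b s :
  tensor_rel (scale_pairs (a + b) s) (scale_pairs a s ++ scale_pairs b s).
Proof.
elim: s => [|[m n] s IHs] /=; first exact: tensor_refl.
rewrite scalerDl; apply: tensor_trans (tensor_cat (tensor_Dl _ _ _) IHs) _.
set A := scale_pairs a s; set B := scale_pairs b s.
apply: (tensor_cat (tensor_refl [:: (a *: m, n)])).
rewrite -[_ ++ (_, _) :: B]cat_rcons -cat_cons -cat1s -cats1.
by apply: tensor_cat; [exact: tensor_catC | exact: tensor_refl].
Qed.

Lemma scale_pairs0 s : tensor_rel (scale_pairs 0 s) [::].
Proof.
elim: s => [|[m n] s IHs] /=; first exact: tensor_refl.
rewrite scale0r; exact: (tensor_cat (tensor_0l n) IHs).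
Qed.

Fact tensor_scaleA a b x :
  tensor_scale a (tensor_scale b x) = tensor_scale (a * b) x.
Proof.
elim/quotW: x => s; rewrite (tensor_scaleE b s) !tensor_scaleE.
rewrite /scale_pairs -map_comp.
by congr (\pi_tensor _); apply: eq_map => p /=; rewrite scalerA.
Qed.
Fact tensor_scale1 : left_id 1 tensor_scale.
Proof.
elim/quotW=> s; rewrite tensor_scaleE /scale_pairs; congr (\pi_tensor _).
by rewrite -[RHS]map_id; apply: eq_map => -[m n] /=; rewrite scale1r.
Qed.
Fact tensor_scaleDr : right_distributive tensor_scale tensor_add.
Proof.
move=> a; elim/quotW=> s; elim/quotW=> t.
by rewrite (tensor_addE s t) !tensor_scaleE tensor_addE /scale_pairs map_cat.
Qed.
Fact tensor_scaleDl x :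
  {morph tensor_scale^~ x : a b / a + b >-> tensor_add a b}.
Proof.
move=> a b; elim/quotW: x => s; rewrite !tensor_scaleE tensor_addE.
exact/tensor_piP/scale_pairsDl.
Qed.
Fact tensor_addN : left_inverse tensor_zero tensor_opp tensor_add.
Proof.
move=> x; rewrite /tensor_opp -{2}[x]tensor_scale1 -tensor_scaleDl addNr.
elim/quotW: x => s; rewrite tensor_scaleE; exact/tensor_piP/scale_pairs0.
Qed.

HB.instance Definition _ :=
  GRing.isZmodule.Build tensor tensor_addA tensor_addC tensor_add0 tensor_addN.
HB.instance Definition _ := GRing.Zmodule_isLmodule.Build R tensor
  tensor_scaleA tensor_scale1 tensor_scaleDr tensor_scaleDl.

Lemma pureDl m m' n : pure (m + m') n = pure m n + pure m' n.
Proof. by rewrite [RHS]tensor_addE; exact/tensor_piP/tensor_Dl. Qed.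
Lemma pureDr m n n' : pure m (n + n') = pure m n + pure m n'.
Proof. by rewrite [RHS]tensor_addE; exact/tensor_piP/tensor_Dr. Qed.
Lemma pureZl a m n : pure (a *: m) n = a *: pure m n.
Proof. by rewrite [RHS]tensor_scaleE. Qed.
Lemma pureZr a m n : pure m (a *: n) = a *: pure m n.
Proof. by rewrite -pureZl; exact/esym/tensor_piP/tensor_Z. Qed.

Lemma pure_linearl n : linear (pure^~ n).
Proof. by move=> a m m'; rewrite pureDl pureZl. Qed.
Lemma pure_linearr m : linear (pure m).
Proof. by move=> a n n'; rewrite pureDr pureZr. Qed.

Lemma tensor_piE s : \pi_tensor s = \sum_(p <- s) pure p.1 p.2.
Proof.
elim: s => [|[m n] s IHs]; first by rewrite big_nil.
by rewrite big_cons -IHs [RHS]tensor_addE.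
Qed.

Lemma tensor_ext (P : lmodType R) (f g : {linear tensor -> P}) :
  (forall m n, f (pure m n) = g (pure m n)) -> f =1 g.
Proof.
move=> fg; elim/quotW=> s; rewrite tensor_piE !linear_sum.
by apply: eq_bigr => p _; exact: fg.
Qed.

Section Lift.
Context (P : lmodType R) (f : M -> N -> P).
Hypotheses (fl : forall n, linear (f^~ n)) (fr : forall m, linear (f m)).

Definition eval_pairs (s : seq (M * N)) : P := \sum_(p <- s) f p.1 p.2.

Lemma eval_pairs_rel s t : tensor_rel s t -> eval_pairs s = eval_pairs t.
Proof.
have flE n : f^~ n =1 mklin (fl n) by [].
have frE m : f m =1 mklin (fr m) by [].
rewrite /eval_pairs; elim=> {s t} //=.
- by move=> s t u _ -> _ ->.
- by move=> s t s' t' _ st _ st'; rewrite !big_cat st st'.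
- by move=> s t; rewrite !big_cat /= addrC.
- by move=> n; rewrite big_seq1 big_nil /= flE linear0.
- by move=> m m' n; rewrite !big_cons !big_nil !addr0 /= !flE linearD.
- by move=> m n n'; rewrite !big_cons !big_nil !addr0 /= !frE linearD.
- by move=> a m n; rewrite !big_seq1 /= flE linearZ frE linearZ.
Qed.

Definition tensor_lift_fun (x : tensor) : P := eval_pairs (repr x).

Lemma tensor_lift_piE s : tensor_lift_fun (\pi_tensor s) = eval_pairs s.
Proof. exact/eval_pairs_rel/tensor_reprP. Qed.

Fact tensor_lift_linear : linear tensor_lift_fun.
Proof.
have flE n : f^~ n =1 mklin (fl n) by [].
move=> a; elim/quotW=> s; elim/quotW=> t.
rewrite [a *: _]tensor_scaleE [_ + _]tensor_addE !tensor_lift_piE /eval_pairs.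
rewrite big_cat /scale_pairs big_map scaler_sumr; congr (_ + _).
by apply: eq_bigr => p _ /=; rewrite flE linearZ.
Qed.

Definition tensor_lift : {linear tensor -> P} := mklin tensor_lift_linear.

Lemma tensor_liftE m n : tensor_lift (pure m n) = f m n.
Proof.
by rewrite [LHS]tensor_lift_piE /eval_pairs big_seq1.
Qed.
End Lift.
End Tensor.

Section TensorMap.
Context (R : comPzRingType) (M M' N N' : lmodType R).
Context (f : {linear M -> M'}) (g : {linear N -> N'}).

Fact tensor_map_linearl n : linear (fun m => pure (f m) (g n)).
Proof. by move=> a m m'; rewrite linearP pure_linearl. Qed.
Fact tensor_map_linearr m : linear (fun n => pure (f m) (g n)).
Proof. by move=> a n n'; rewrite linearP pure_linearr. Qed.

Definition tensor_map : {linear tensor M N -> tensor M' N'} :=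
  tensor_lift tensor_map_linearl tensor_map_linearr.

Lemma tensor_mapE m n : tensor_map (pure m n) = pure (f m) (g n).
Proof. exact: tensor_liftE. Qed.
End TensorMap.

Definition flat (R : comPzRingType) (M : lmodType R) : Prop :=
  forall (N N' : lmodType R) (g : {linear N -> N'}),
    injective g -> injective (tensor_map (idfun : {linear M -> M}) g).

Section Submodules.
Context (R : comPzRingType) (V : lmodType R).

(* [submodClosed V] is the type of submodules of V. *)
Definition submod (S : submodClosed V) : Type := {x : V | x \in S}.

HB.instance Definition _ (S : submodClosed V) := SubType.on (submod S).
HB.instance Definition _ (S : submodClosed V) := [Choice of submod S by <:].
HB.instance Definition _ (S : submodClosed V) :=
  [SubChoice_isSubLmodule of submod S by <:].

Definition submod_span (s : seq V) : {pred V} :=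
  [pred x | `[< exists c : nat -> R, x = \sum_(i < size s) c i *: s`_i >]].

Definition finitely_generated (S : {pred V}) : Prop :=
  exists s : seq V, S =i submod_span s.

Fact submod_span_closed s : submod_closed (submod_span s).
Proof.
split=> [|a x y].
  apply/asboolP; exists (fun=> 0).
  by rewrite big1 // => i _; rewrite scale0r.
move=> /asboolP[c ->] /asboolP[d ->]; apply/asboolP.
exists (fun i => a * c i + d i); rewrite scaler_sumr -big_split.
by apply: eq_bigr => i _; rewrite scalerDl scalerA.
Qed.

HB.instance Definition _ s :=
  GRing.isSubmodClosed.Build R V (submod_span s) (submod_span_closed s).

Lemma mem_submod_span s x : x \in s -> x \in submod_span s.
Proof.
move=> xs; apply/asboolP; exists (fun i => (i == index x s)%:R).
have lt_xs : (index x s < size s)%N by rewrite index_mem.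
rewrite (bigD1 (Ordinal lt_xs)) //= eqxx scale1r nth_index // big1 ?addr0 //.
move=> i /negbTE; rewrite -val_eqE /= => ->; exact: scale0r.
Qed.

Lemma submod_span_sub s (S : submodClosed V) :
  {subset s <= S} -> {subset submod_span s <= S}.
Proof.
move=> sS x /asboolP[c ->]; apply: rpred_sum => i _; apply: rpredZ.
exact/sS/mem_nth.
Qed.
End Submodules.

(* Ideals of R are the submodules of R^o. *)
Definition noetherian (R : comPzRingType) : Prop :=
  forall I : submodClosed R^o, finitely_generated I.

(* [dp_base] makes the index nonempty. *)
Record directed_preorder := DirectedPreorder {
  dp_sort :> Type;
  dp_le : dp_sort -> dp_sort -> Prop;
  dp_refl : forall i, dp_le i i;
  dp_trans : forall i j k, dp_le i j -> dp_le j k -> dp_le i k;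
  dp_base : dp_sort;
  dp_directed : forall i j, exists k, dp_le i k /\ dp_le j k }.

(* The laws hold for all proofs of the order hypotheses, so the transition *)
(* morphisms do not depend on these proofs.                                *)
Record directed_system (R : comPzRingType) (I : directed_preorder) :=
  DirectedSystem {
  ds_obj :> I -> lmodType R;
  ds_tr : forall i j, dp_le i j -> {linear ds_obj i -> ds_obj j};
  ds_tr_id : forall i (h : dp_le i i) x, ds_tr h x = x;
  ds_tr_comp : forall i j k (hij : dp_le i j) (hjk : dp_le j k)
    (hik : dp_le i k) x, ds_tr hjk (ds_tr hij x) = ds_tr hik x }.

Section DirectLimit.
Context (R : comPzRingType) (I : directed_preorder) (F : directed_system R I).

Definition dlim_pre := {classic {i : I & F i}}.

Definition dlim_rel (x y : dlim_pre) : Prop :=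
  exists k (hx : dp_le (tag x) k) (hy : dp_le (tag y) k),
    ds_tr F hx (tagged x) = ds_tr F hy (tagged y).

Definition dlim_relb x y := `[< dlim_rel x y >].

Fact dlim_relb_refl : reflexive dlim_relb.
Proof.
by move=> x; apply/asboolP; exists (tag x), (dp_refl _), (dp_refl _).
Qed.
Fact dlim_relb_sym : symmetric dlim_relb.
Proof.
by move=> x y; apply/asboolP/asboolP => -[k [hx [hy e]]]; exists k, hy, hx.
Qed.
Fact dlim_relb_trans : transitive dlim_relb.
Proof.
move=> y x z /asboolP[k [hx [hy e]]] /asboolP[l [hy' [hz e']]]; apply/asboolP.
have [m [km lm]] := dp_directed k l.
exists m, (dp_trans hx km), (dp_trans hz lm).
rewrite -(ds_tr_comp hx km) e (ds_tr_comp _ _ (dp_trans hy km)).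
by rewrite -(ds_tr_comp hz lm) -e' (ds_tr_comp _ _ (dp_trans hy km)).
Qed.

Canonical dlim_equiv :=
  EquivRel dlim_relb dlim_relb_refl dlim_relb_sym dlim_relb_trans.

Definition dlim := {eq_quot dlim_equiv}.

HB.instance Definition _ := Choice.on dlim.
HB.instance Definition _ := EqQuotient.on dlim.

Definition dlim_in_fun (i : I) (x : F i) : dlim :=
  \pi_dlim (existT (fun i => F i) i x : dlim_pre).

Lemma dlim_inP i j (x : F i) (y : F j) :
  dlim_in_fun x = dlim_in_fun y <->
  exists k (hi : dp_le i k) (hj : dp_le j k), ds_tr F hi x = ds_tr F hj y.
Proof.
split=> [/eqmodP/asboolP//|xy]; exact/eqmodP/asboolP.
Qed.

Lemma dlim_in_tr_fun i j (h : dp_le i j) x :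
  dlim_in_fun (ds_tr F h x) = dlim_in_fun x.
Proof. by apply/dlim_inP; exists j, (dp_refl j), h; rewrite ds_tr_id. Qed.

Lemma dlimW (P : dlim -> Prop) :
  (forall i (x : F i), P (dlim_in_fun x)) -> forall x, P x.
Proof. by move=> Pin; elim/quotW=> -[i x]; exact: Pin. Qed.

Lemma dlimW2 (P : dlim -> dlim -> Prop) :
  (forall i (x y : F i), P (dlim_in_fun x) (dlim_in_fun y)) ->
  forall x y, P x y.
Proof.
move=> Pin; elim/dlimW=> i x; elim/dlimW=> j y.
have [k [ik jk]] := dp_directed i j.
by rewrite -(dlim_in_tr_fun ik) -(dlim_in_tr_fun jk).
Qed.

Definition dlim_top (i j : I) := cid (dp_directed i j).

Definition dlim_zero : dlim := dlim_in_fun (0 : F (dp_base I)).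
Definition dlim_add (x y : dlim) : dlim :=
  let: existT i u := repr x in let: existT j v := repr y in
  let: exist k (conj ik jk) := dlim_top i j in
  dlim_in_fun (ds_tr F ik u + ds_tr F jk v).
Definition dlim_scale (a : R) (x : dlim) : dlim :=
  dlim_in_fun (a *: tagged (repr x)).
Definition dlim_opp (x : dlim) : dlim := dlim_scale (-1) x.

Lemma dlim_reprP i (x : F i) :
  dlim_in_fun (tagged (repr (dlim_in_fun x))) = dlim_in_fun x.
Proof.
rewrite -[RHS]reprK; case: (repr _) => j y; exact: erefl.
Qed.

Lemma dlim_addE i (x y : F i) :
  dlim_add (dlim_in_fun x) (dlim_in_fun y) = dlim_in_fun (x + y).
Proof.
rewrite /dlim_add; have := dlim_reprP x; have := dlim_reprP y.
case: (repr _) => j v /= /dlim_inP[k [jk [ik ev]]].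
case: (repr _) => l u /= /dlim_inP[m [lm [im eu]]].
case: dlim_top => n [ln jn]; apply/dlim_inP.
have [p [kp mp]] := dp_directed k m; have [q [pq nq]] := dp_directed p n.
have kq := dp_trans kp pq; have mq := dp_trans mp pq.
exists q, nq, (dp_trans ik kq); rewrite !linearD.
rewrite (ds_tr_comp ln nq (dp_trans lm mq)) -(ds_tr_comp lm mq) eu.
rewrite (ds_tr_comp im mq (dp_trans ik kq)).
rewrite (ds_tr_comp jn nq (dp_trans jk kq)) -(ds_tr_comp jk kq) ev.
by rewrite (ds_tr_comp ik kq (dp_trans ik kq)).
Qed.

Lemma dlim_scaleE a i (x : F i) :
  dlim_scale a (dlim_in_fun x) = dlim_in_fun (a *: x).
Proof.
rewrite /dlim_scale; have := dlim_reprP x.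
case: (repr _) => j v /= /dlim_inP[k [jk [ik e]]].
by apply/dlim_inP; exists k, jk, ik; rewrite !linearZ e.
Qed.

Lemma dlim_zeroE i : dlim_in_fun (0 : F i) = dlim_zero.
Proof.
have [k [ik bk]] := dp_directed i (dp_base I).
by apply/dlim_inP; exists k, ik, bk; rewrite !linear0.
Qed.

Fact dlim_addC : commutative dlim_add.
Proof.
by move=> x y; elim/dlimW2: x / y => i x y; rewrite !dlim_addE addrC.
Qed.
Fact dlim_addA : associative dlim_add.
Proof.
move=> x y z; elim/dlimW2: y / z => j y z; elim/dlimW: x => i x.
have [k [ik jk]] := dp_directed i j.
rewrite -(dlim_in_tr_fun ik) -!(dlim_in_tr_fun jk).
by rewrite !dlim_addE addrA.
Qed.
Fact dlim_add0 : left_id dlim_zero dlim_add.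
Proof. by elim/dlimW=> i x; rewrite -(dlim_zeroE i) dlim_addE add0r. Qed.
Fact dlim_addN : left_inverse dlim_zero dlim_opp dlim_add.
Proof.
elim/dlimW=> i x; rewrite /dlim_opp dlim_scaleE dlim_addE scaleN1r addNr.
exact: dlim_zeroE.
Qed.

HB.instance Definition _ :=
  GRing.isZmodule.Build dlim dlim_addA dlim_addC dlim_add0 dlim_addN.

Fact dlim_scaleA a b x : dlim_scale a (dlim_scale b x) = dlim_scale (a * b) x.
Proof. by elim/dlimW: x => i x; rewrite !dlim_scaleE scalerA. Qed.
Fact dlim_scale1 : left_id 1 dlim_scale.
Proof. by elim/dlimW=> i x; rewrite dlim_scaleE scale1r. Qed.
Fact dlim_scaleDr : right_distributive dlim_scale +%R.
Proof.
move=> a x y; elim/dlimW2: x / y => i x y.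
by rewrite [X in dlim_scale a X]dlim_addE !dlim_scaleE [RHS]dlim_addE scalerDr.
Qed.
Fact dlim_scaleDl x : {morph dlim_scale^~ x : a b / a + b}.
Proof.
move=> a b; elim/dlimW: x => i x.
by rewrite !dlim_scaleE [RHS]dlim_addE scalerDl.
Qed.

HB.instance Definition _ := GRing.Zmodule_isLmodule.Build R dlim
  dlim_scaleA dlim_scale1 dlim_scaleDr dlim_scaleDl.

Fact dlim_in_linear i : linear (@dlim_in_fun i).
Proof.
by move=> a x y; rewrite [a *: dlim_in_fun x]dlim_scaleE [RHS]dlim_addE.
Qed.

Definition dlim_in i : {linear F i -> dlim} := mklin (@dlim_in_linear i).

Lemma dlim_in_tr i j (h : dp_le i j) x :
  dlim_in j (ds_tr F h x) = dlim_in i x.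
Proof. exact: dlim_in_tr_fun. Qed.

Lemma dlim_ext (P : lmodType R) (f g : {linear dlim -> P}) :
  (forall i x, f (dlim_in i x) = g (dlim_in i x)) -> f =1 g.
Proof. by move=> fg; elim/dlimW=> i x; exact: fg. Qed.

Section Lift.
Context (P : lmodType R) (phi : forall i, {linear F i -> P}).
Hypothesis phi_tr : forall i j (h : dp_le i j) x, phi j (ds_tr F h x) = phi i x.

Definition dlim_lift_fun (x : dlim) : P := phi _ (tagged (repr x)).

Lemma dlim_lift_inE i (x : F i) : dlim_lift_fun (dlim_in_fun x) = phi i x.
Proof.
rewrite /dlim_lift_fun; have := dlim_reprP x.
case: (repr _) => j v /= /dlim_inP[k [jk [ik e]]].
by rewrite -(phi_tr jk) e phi_tr.
Qed.

Fact dlim_lift_linear : linear dlim_lift_fun.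
Proof.
move=> a x y; elim/dlimW2: x / y => i x y.
by rewrite [a *: _]dlim_scaleE [_ + _]dlim_addE !dlim_lift_inE linearP.
Qed.

Definition dlim_lift : {linear dlim -> P} := mklin dlim_lift_linear.

Lemma dlim_liftE i x : dlim_lift (dlim_in i x) = phi i x.
Proof. exact: dlim_lift_inE. Qed.
End Lift.
End DirectLimit.

Section DirectLimitMap.
Context (R : comPzRingType) (I : directed_preorder).
Context (F G : directed_system R I) (eta : forall i, {linear F i -> G i}).
Hypothesis eta_tr : forall i j (h : dp_le i j) x,
  eta j (ds_tr F h x) = ds_tr G h (eta i x).

Definition dlim_map_at i : {linear F i -> dlim G} := dlim_in G i \o eta i.

Fact dlim_map_at_tr i j (h : dp_le i j) x :
  dlim_map_at j (ds_tr F h x) = dlim_map_at i x.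
Proof. by rewrite /dlim_map_at /= eta_tr [LHS]dlim_in_tr. Qed.

Definition dlim_map : {linear dlim F -> dlim G} := dlim_lift dlim_map_at_tr.

Lemma dlim_mapE i x : dlim_map (dlim_in F i x) = dlim_in G i (eta i x).
Proof. exact: dlim_liftE. Qed.
End DirectLimitMap.

Section FinitelyGeneratedSubmodules.
Context (R : comPzRingType) (M : lmodType R).

Record fgsub := FgSub {
  fgsub_sub :> submodClosed M;
  fgsubP : finitely_generated fgsub_sub }.

Definition fgsub_le (i j : fgsub) : Prop := {subset i <= j}.

Definition fg_span (s : seq M) : fgsub :=
  @FgSub (submod_span s) (ex_intro _ s (fun=> erefl)).

Fact fgsub_refl i : fgsub_le i i. Proof. by []. Qed.
Fact fgsub_trans i j k : fgsub_le i j -> fgsub_le j k -> fgsub_le i k.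
Proof. by move=> ij jk x /ij/jk. Qed.
Fact fgsub_directed i j : exists k, fgsub_le i k /\ fgsub_le j k.
Proof.
case: (fgsubP i) (fgsubP j) => [s iE] [t jE]; exists (fg_span (s ++ t)).
by split=> x; rewrite (iE, jE); apply: submod_span_sub => y ys;
  apply: mem_submod_span; rewrite mem_cat ys ?orbT.
Qed.

Definition fgsubs : directed_preorder :=
  DirectedPreorder fgsub_refl fgsub_trans (fg_span [::]) fgsub_directed.

Section Inclusion.
Context (i j : fgsubs) (h : dp_le i j).

Definition incl_fun (x : submod i) : submod j := Sub (val x) (h (valP x)).

Fact incl_linear : linear incl_fun.
Proof.
move=> a x y; apply: val_inj; rewrite [RHS]linearP.
exact: (linearP (val : {linear submod i -> M})).
Qed.

Definition incl : {linear submod i -> submod j} := mklin incl_linear.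

Lemma val_incl x : val (incl x) = val x. Proof. by []. Qed.
End Inclusion.

Definition dual_mod (V : lmodType R) : lmodType R := {linear V -> R^o}.

Section DualRestriction.
Context (i j : fgsubs) (h : dp_le i j).

Definition restr_fun (w : dual_mod (submod j)) : dual_mod (submod i) :=
  w \o incl h.

Fact restr_linear : linear restr_fun.
Proof. by move=> a v w; exact: linear_ext. Qed.

Definition restr : {linear dual_mod (submod j) -> dual_mod (submod i)} :=
  mklin restr_linear.
End DualRestriction.

(* The system of the M_i (x) N, that of the Hom(M_i^*, N), and the morphism  *)
(* M (x) N = colim (M_i (x) N) -> colim Hom(M_i^*, N).                       *)
Section Comparison.
Context (N : lmodType R).

Section TensorSystem.
Definition tensor_tr i j (h : @dp_le fgsubs i j) :
    {linear tensor (submod i) N -> tensor (submod j) N} :=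
  tensor_map (incl h) idfun.

Lemma tensor_trE i j (h : dp_le i j) m n :
  @tensor_tr i j h (pure m n) = pure (incl h m) n.
Proof. exact: tensor_mapE. Qed.

Fact tensor_tr_id i (h : dp_le i i) x : @tensor_tr i i h x = x.
Proof.
apply: (tensor_ext (g := idfun)) => m n; rewrite tensor_trE /=.
by congr pure; apply: val_inj.
Qed.
Fact tensor_tr_comp i j k (hij : dp_le i j) (hjk : dp_le j k) (hik : dp_le i k)
  x : tensor_tr hjk (tensor_tr hij x) = tensor_tr hik x.
Proof.
apply: (tensor_ext (f := tensor_tr hjk \o tensor_tr hij)) => m n.
rewrite -[LHS]/(tensor_tr hjk (tensor_tr hij _)) !tensor_trE.
by congr pure; apply: val_inj.
Qed.

Definition tensor_system : directed_system R fgsubs :=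
  DirectedSystem tensor_tr_id tensor_tr_comp.
End TensorSystem.

Section HomDualSystem.
Section Transition.
Context (i j : fgsubs) (h : dp_le i j).

Definition homdual_tr_fun (u : {linear dual_mod (submod i) -> N}) :
  {linear dual_mod (submod j) -> N} := u \o restr h.

Fact homdual_tr_linear : linear homdual_tr_fun.
Proof. by move=> a u v; exact: linear_ext. Qed.

Definition homdual_tr := mklin homdual_tr_linear.
End Transition.

Fact homdual_tr_id i (h : dp_le i i) u : homdual_tr h u = u.
Proof.
apply: linear_ext => w /=; congr (u _); apply: linear_ext => x /=.
by congr (w _); apply: val_inj.
Qed.
Fact homdual_tr_comp i j k (hij : dp_le i j) (hjk : dp_le j k)
  (hik : dp_le i k) u : homdual_tr hjk (homdual_tr hij u) = homdual_tr hik u.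
Proof.
apply: linear_ext => w /=; congr (u _); apply: linear_ext => x /=.
by congr (w _); apply: val_inj.
Qed.

Definition homdual_system : directed_system R fgsubs :=
  DirectedSystem homdual_tr_id homdual_tr_comp.
End HomDualSystem.

Section Natural.
Context (i : fgsubs).

Fact nat_pure_linear (m : submod i) (n : N) :
  linear (fun w : dual_mod (submod i) => (w m : R) *: n).
Proof. by move=> a v w; rewrite scalerDl scalerA. Qed.

Definition nat_pure m n : {linear dual_mod (submod i) -> N} :=
  mklin (nat_pure_linear m n).

Fact nat_pure_linearl n : linear (nat_pure^~ n).
Proof.
by move=> a m m'; apply: linear_ext => w /=; rewrite linearP scalerDl scalerA.
Qed.
Fact nat_pure_linearr m : linear (nat_pure m).
Proof.
move=> a n n'; apply: linear_ext => w /=.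
by rewrite scalerDr !scalerA mulrC.
Qed.

Definition nat_map :
    {linear tensor (submod i) N -> {linear dual_mod (submod i) -> N}} :=
  tensor_lift nat_pure_linearl nat_pure_linearr.
End Natural.

Lemma nat_mapE i m n w : nat_map i (pure m n) w = (w m : R) *: n.
Proof. by rewrite [nat_map _ _]tensor_liftE. Qed.

Fact nat_map_tr i j (h : dp_le i j) (x : tensor_system i) :
  nat_map j (ds_tr tensor_system h x) = ds_tr homdual_system h (nat_map i x).
Proof.
apply: (tensor_ext (f := nat_map j \o tensor_tr h)
                   (g := homdual_tr h \o nat_map i)) => m n.
apply: linear_ext => w.
rewrite -[LHS]/(nat_map j (tensor_tr h _) w) -[RHS]/(nat_map i _ (restr h w)).
by rewrite tensor_trE !nat_mapE.
Qed.

(* The identification of M (x) N with the direct limit of the M_i (x) N. *)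
Definition tensor_colim_at i : {linear tensor_system i -> tensor M N} :=
  tensor_map (val : {linear submod i -> M}) idfun.

Lemma tensor_colim_atE i m n :
  tensor_colim_at i (pure m n) = pure (val m) n.
Proof. exact: tensor_mapE. Qed.

Fact tensor_colim_at_tr i j (h : dp_le i j) x :
  tensor_colim_at j (ds_tr tensor_system h x) = tensor_colim_at i x.
Proof.
apply: (tensor_ext (f := tensor_colim_at j \o tensor_tr h)) => m n.
rewrite -[LHS]/(tensor_colim_at j (tensor_tr h _)).
by rewrite tensor_trE !tensor_colim_atE.
Qed.

Definition of_tensor_colim : {linear dlim tensor_system -> tensor M N} :=
  dlim_lift tensor_colim_at_tr.

Lemma mem_fg_span1 (m : M) : m \in fg_span [:: m].
Proof. by apply: mem_submod_span; rewrite mem_head. Qed.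

Definition to_tensor_colim_pure (m : M) (n : N) : dlim tensor_system :=
  dlim_in tensor_system (fg_span [:: m])
    (pure (Sub m (mem_fg_span1 m) : submod (fg_span [:: m])) n).

Lemma to_tensor_colim_pureE (i : fgsubs) (m : submod i) n :
  to_tensor_colim_pure (val m) n = dlim_in tensor_system i (pure m n).
Proof.
have h : @dp_le fgsubs (fg_span [:: val m]) i.
  by apply: submod_span_sub => x; rewrite inE => /eqP->; exact: valP.
rewrite -[LHS](dlim_in_tr (F := tensor_system) h) [ds_tr _ _ _]tensor_trE.
by congr (dlim_in tensor_system i _); congr pure; apply: val_inj.
Qed.

Fact to_tensor_colim_linearl n : linear (to_tensor_colim_pure^~ n).
Proof.
move=> a m m'; pose i : fgsubs := fg_span [:: m; m'].
have mi : m \in i by apply: mem_submod_span; rewrite mem_head.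
have mi' : m' \in i by apply: mem_submod_span; rewrite !inE eqxx orbT.
rewrite -[m]/(val (Sub m mi : submod i)) -[m']/(val (Sub m' mi' : submod i)).
by rewrite -linearP !to_tensor_colim_pureE pure_linearl linearP.
Qed.
Fact to_tensor_colim_linearr m : linear (to_tensor_colim_pure m).
Proof.
by move=> a n n'; rewrite /to_tensor_colim_pure pure_linearr linearP.
Qed.

Definition to_tensor_colim : {linear tensor M N -> dlim tensor_system} :=
  tensor_lift to_tensor_colim_linearl to_tensor_colim_linearr.

Lemma to_tensor_colimK : cancel to_tensor_colim of_tensor_colim.
Proof.
apply: (tensor_ext (f := of_tensor_colim \o to_tensor_colim) (g := idfun)).
move=> m n; rewrite -[LHS]/(of_tensor_colim (to_tensor_colim _)).
by rewrite [to_tensor_colim _]tensor_liftE [LHS]dlim_liftE tensor_colim_atE.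
Qed.

Lemma of_tensor_colimK : cancel of_tensor_colim to_tensor_colim.
Proof.
apply: (dlim_ext (f := to_tensor_colim \o of_tensor_colim) (g := idfun)).
move=> i x; rewrite -[LHS]/(to_tensor_colim (of_tensor_colim _)).
rewrite [of_tensor_colim _]dlim_liftE.
apply: (tensor_ext (f := to_tensor_colim \o tensor_colim_at i)
                   (g := dlim_in tensor_system i)) => m n.
rewrite -[LHS]/(to_tensor_colim (tensor_colim_at i _)).
rewrite tensor_colim_atE [LHS]tensor_liftE.
exact: to_tensor_colim_pureE.
Qed.

Definition dlim_nat_map : {linear dlim tensor_system -> dlim homdual_system} :=
  dlim_map (F := tensor_system) (G := homdual_system) (eta := nat_map)
    nat_map_tr.

Definition comparison : {linear tensor M N -> dlim homdual_system} :=
  dlim_nat_map \o to_tensor_colim.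

Lemma to_tensor_colim_atE i (x : tensor_system i) :
  to_tensor_colim (tensor_colim_at i x) = dlim_in tensor_system i x.
Proof.
by rewrite -(dlim_liftE tensor_colim_at_tr) [to_tensor_colim _]of_tensor_colimK.
Qed.

Lemma comparisonE i (x : tensor_system i) :
  comparison (tensor_colim_at i x) = dlim_in homdual_system i (nat_map i x).
Proof.
apply: (etrans (congr1 dlim_nat_map (to_tensor_colim_atE x))).
exact: dlim_mapE.
Qed.
End Comparison.
End FinitelyGeneratedSubmodules.

(* Main.v *)
(* If M is flat and R is Noetherian, the finitely generated module M_i is     *)
(* finitely presented, so the inclusion of M_i in M factors through a finite  *)
(* free module: y = sum_k phi_k(y) m_k for some phi_k in M_i^*, m_k in M. The *)
(* factorization comes from the exactness of M (x) - applied to the kernel of *)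
(* the map R^n -> R^p given by the relations between the n generators of M_i. *)
(* Then u |-> sum_k m_k (x) u(phi_k), from Hom(M_i^*, N) to M (x) N, inverts  *)
(* the comparison morphism in the limit. Conversely, Hom(M_i^*, -) and        *)
(* filtered colimits preserve injections, so the comparison isomorphism       *)
(* transfers this property to M (x) -.                                        *)
Require Import Defs.
From mathcomp Require Import all_boot all_order all_algebra.
From HB Require Import structures.
From mathcomp Require Import generic_quotient boolp.

Set Implicit Arguments.
Unset Strict Implicit.
Unset Printing Implicit Defensive.

Import GRing.Theory.
Local Open Scope ring_scope.
Local Open Scope quotient_scope.

(** For flat [M] over a Noetherian ring the heart is [flat_factor]: each [y] in [M_i] equals
    [sum_k phi_k(y) m_k] for fixed [phi_k] in [M_i^*] and [m_k] in [M]. This is the equational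
    criterion of flatness: by [noetherian_row] the relations between the generators of [M_i] are
    finitely generated, [flat_relations] expresses the generators through rows orthogonal to these
    relations, and [dual_of_row] turns such rows into functionals on [M_i]. The assignment of
    [sum_k m_k (x) u(phi_k)] to [u] then recovers the image of a tensor in [M (x) N] from its
    [nat_map] ([factored_colim_at]), which gives injectivity, and yields preimages
    ([factored_comparison]), which gives surjectivity. Conversely, [comparison_reflects_injective]
    tests the vanishing of a tensor after [comparison], where an injective [g] can be cancelled
    pointwise. *)

Lemma inj_surj_bijective (T U : Type) (f : T -> U) :
  injective f -> (forall y, exists x, f x = y) -> bijective f.
Proof.
move=> f_inj f_surj; exists (fun y => sval (cid (f_surj y))) => [x|y].
  by apply: f_inj; case: cid.
by case: cid.
Qed.

Lemma hom_sumE (R : comPzRingType) (U V : lmodType R) (I : Type) (r : seq I)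
    (F : I -> {linear U -> V}) u :
  (\sum_(i <- r) F i) u = \sum_(i <- r) F i u.
Proof. by elim/big_rec2: _ => // i f v _ <-. Qed.

Lemma linear_inj_ker (R : pzRingType) (U V : lmodType R) (f : {linear U -> V}) :
  (forall x, f x = 0 -> x = 0) -> injective f.
Proof.
move=> f0 x y fxy; apply/eqP; rewrite -subr_eq0; apply/eqP/f0.
by rewrite linearB fxy subrr.
Qed.

(** * Finite generation of the submodules of R^n *)

Section Span.
Context (R : comPzRingType) (U V : lmodType R).

Lemma submod_span_map (f : {linear U -> V}) (s : seq U) y :
  y \in submod_span (map f s) -> exists2 x, x \in submod_span s & y = f x.
Proof.
move=> /asboolP[c ->]; rewrite size_map.
exists (\sum_(i < size s) c i *: s`_i); first by apply/asboolP; exists c.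
by rewrite linear_sum; apply: eq_bigr => i _; rewrite linearZ (nth_map 0).
Qed.

Lemma map_lift (f : U -> V) (P : U -> Prop) (t : seq V) :
  (forall y, y \in t -> exists2 x, P x & f x = y) ->
  exists2 s, (forall x, x \in s -> P x) & map f s = t.
Proof.
elim: t => [|y t IHt] tP; first by exists [::].
have [x Px fx] := tP y (mem_head _ _).
have [|s sP fs] := IHt; first by move=> z zt; apply: tP; rewrite inE zt orbT.
exists (x :: s); last by rewrite /= fx fs.
by move=> z; rewrite inE => /predU1P[->|/sP].
Qed.

(** Lifts of generators of [f(K)] take care of [x] up to an element of [K] killed by [f], which the
    generators of the kernel part then reach. *)
Lemma finitely_generated_extension (f : {linear U -> V}) (K : submodClosed U) :
  finitely_generated [pred y | `[< exists2 x, x \in K & f x = y >]] ->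
  finitely_generated [pred x in K | f x == 0] ->
  finitely_generated K.
Proof.
move=> [t tE] [s' s'E].
have [|s sK fs] := @map_lift f (fun x => x \in K) t.
  by move=> y /mem_submod_span; rewrite -tE => /asboolP.
exists (s ++ s') => x; apply/idP/idP.
  move=> xK; have: f x \in submod_span t by rewrite -tE; apply/asboolP; exists x.
  rewrite -fs => /submod_span_map[z zs fxz].
  have zK : z \in K by exact: submod_span_sub zs.
  have: x - z \in submod_span s'.
    rewrite -s'E; apply/andP; split; last first.
      by rewrite /= linearB fxz subrr.
    by rewrite -scaleN1r; apply: rpredD => //; exact: rpredZ.
  move=> xz; rewrite -[x](subrK z); apply: rpredD.
    apply: (submod_span_sub (S := submod_span (s ++ s'))) xz => y ys; apply: mem_submod_span.
    by rewrite mem_cat ys orbT.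
  apply: (submod_span_sub (S := submod_span (s ++ s'))) zs => y ys; apply: mem_submod_span.
  by rewrite mem_cat ys.
apply: submod_span_sub => y; rewrite mem_cat => /orP[/sK//|].
by move=> /mem_submod_span; rewrite -s'E => /andP[].
Qed.
End Span.

Section Noetherian.
Context (R : comPzRingType) (noethR : noetherian R).

Fact row_coord_linear n (i : 'I_n) : linear (fun v : 'rV[R]_n => v 0 i : R^o).
Proof. by move=> a u v; rewrite !mxE. Qed.

Definition row_coord n (i : 'I_n) := mklin (row_coord_linear i).

Lemma noetherian_row n (K : {pred 'rV[R]_n}) :
  submod_closed K -> finitely_generated K.
Proof.
move=> Kclosed.
(* Induction on the number [k] of coordinates that may be nonzero. *)
suff: forall k (S : {pred 'rV[R]_n}), submod_closed S ->
    (forall v (i : 'I_n), v \in S -> (k <= i)%N -> v 0 i = 0) ->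
    finitely_generated S.
  by move/(_ n K Kclosed); apply=> v i _; rewrite leqNgt ltn_ord.
elim=> [|k IHk] S Sclosed S0.
  exists [::] => v; apply/idP/idP.
    move=> vS; suff ->: v = 0 by exact: rpred0.
    by apply/rowP=> i; rewrite mxE; exact: S0.
  by move=> /asboolP[c ->]; rewrite big_ord0; case: Sclosed.
pose S' : submodClosed 'rV[R]_n :=
  HB.pack_for (submodClosed 'rV[R]_n) S (GRing.isSubmodClosed.Build _ _ S Sclosed).
have [le_nk|lt_kn] := leqP n k.
  apply: IHk => // v i _ ki.
  by have := leq_ltn_trans ki (ltn_ord i); rewrite ltnNge le_nk.
(* Coordinate [k] splits [S]: its image is an ideal of [R], and the part of [S] where it vanishes
   has all coordinates from [k] on equal to zero. *)
pose f := row_coord (Ordinal lt_kn).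
pose I_pred : {pred R^o} := [pred y | `[< exists2 x, x \in S' & f x = y >]].
have Iclosed : submod_closed I_pred.
  split; first by apply/asboolP; exists 0; rewrite ?rpred0 ?linear0.
  move=> a _ _ /asboolP[x xS <-] /asboolP[y yS <-]; apply/asboolP.
  by exists (a *: x + y); rewrite ?linearP // rpredD // rpredZ.
apply: (@finitely_generated_extension _ _ _ f S').
  pose I : submodClosed R^o := HB.pack_for (submodClosed R^o) I_pred
    (GRing.isSubmodClosed.Build R R^o I_pred Iclosed).
  exact: (noethR I).
apply: IHk => [|v i].
  split; first by apply/andP; split; [exact: rpred0 | exact/eqP/linear0].
  move=> a x y /andP[/= xS /eqP fx] /andP[/= yS /eqP fy].
  apply/andP; split; first exact: Sclosed.2.
  by apply/eqP/(etrans (linearP f a x y)); rewrite /= fx fy scaler0 addr0.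
move=> /andP[/= vS /eqP fv]; rewrite leq_eqVlt => /predU1P[ki|]; last exact: S0.
by rewrite -[RHS]fv /=; congr (v 0 _); exact/val_inj.
Qed.
End Noetherian.

(** * Right exactness of the tensor product, and exactness for flat modules *)

Section Tensors.
Context (R : comPzRingType).
Implicit Types (M N U V : lmodType R).

Lemma pureNr M N (m : M) (n : N) : pure m (- n) = - pure m n.
Proof. by rewrite -scaleN1r pureZr scaleN1r. Qed.

Lemma tensor_ind M N (P : tensor M N -> Prop) :
  P 0 -> (forall m n x, P x -> P (pure m n + x)) -> forall x, P x.
Proof.
move=> P0 Pcons; elim/quotW=> s; rewrite tensor_piE.
by elim: s => [|[m n] s IHs]; rewrite ?big_nil // big_cons; exact: Pcons.
Qed.

Section RightExact.
Context (M U V : lmodType R) (f : {linear U -> V}) (sigma : V -> U).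
Hypothesis sigmaK : cancel sigma f.

(** The image of [M (x) ker f] in [M (x) U]. *)
Definition ker_tensor (x : tensor M U) : Prop :=
  exists2 s : seq (M * U), (forall p, p \in s -> f p.2 = 0)
    & x = \sum_(p <- s) pure p.1 p.2.

Lemma ker_tensor0 : ker_tensor 0.
Proof. by exists [::]; rewrite ?big_nil. Qed.

Lemma ker_tensor_pure m u : f u = 0 -> ker_tensor (pure m u).
Proof.
by move=> fu; exists [:: (m, u)]; rewrite ?big_seq1 // => p; rewrite inE => /eqP->.
Qed.

Lemma ker_tensorD x y : ker_tensor x -> ker_tensor y -> ker_tensor (x + y).
Proof.
move=> [s s0 ->] [t t0 ->]; exists (s ++ t); last by rewrite big_cat.
by move=> p; rewrite mem_cat => /orP[/s0|/t0].
Qed.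

Lemma ker_tensorN x : ker_tensor x -> ker_tensor (- x).
Proof.
move=> [s s0 ->]; exists [seq (p.1, - p.2) | p <- s].
  by move=> _ /mapP[p ps ->] /=; rewrite linearN s0 ?oppr0.
rewrite big_map -sumrN; by apply: eq_bigr => p _; rewrite pureNr.
Qed.

Definition section_sum (s : seq (M * V)) : tensor M U :=
  \sum_(p <- s) pure p.1 (sigma p.2).

(* [sigma] is a mere set-theoretic section, but it is linear modulo [ker f]. *)
Lemma section_sum_rel s t :
  tensor_rel s t -> ker_tensor (section_sum s - section_sum t).
Proof.
rewrite /section_sum; elim=> {s t}.
- by move=> s; rewrite subrr; exact: ker_tensor0.
- by move=> s t _ /ker_tensorN; rewrite opprB.
- by move=> s t u _ st _ /(ker_tensorD st); rewrite addrA subrK.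
- move=> s t s' t' _ st _ /(ker_tensorD st).
  by rewrite !big_cat /= opprD addrACA.
- by move=> s t; rewrite !big_cat /= addrC subrr; exact: ker_tensor0.
- move=> n; rewrite big_seq1 big_nil subr0 /= -[0](scale0r 0) pureZl scale0r.
  exact: ker_tensor0.
- move=> m m' n; rewrite !big_cons !big_nil /= !addr0 pureDl subrr.
  exact: ker_tensor0.
- move=> m n n'; rewrite !big_cons !big_nil /= !addr0 -pureDr.
  rewrite -pureNr -pureDr; apply: ker_tensor_pure.
  by rewrite linearB linearD !sigmaK subrr.
- move=> a m n; rewrite !big_seq1 /= pureZl -pureZr.
  rewrite -pureNr -pureDr; apply: ker_tensor_pure.
  by rewrite linearB linearZ /= !sigmaK subrr.
Qed.

(** Pulling the image of a formal sum back along [sigma] gives an element of [ker_tensor], and this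
    differs from [x] by terms [pure m (u - sigma (f u))], whose second factor lies in [ker f]. *)
Lemma tensor_right_exact x :
  tensor_map (idfun : {linear M -> M}) f x = 0 -> ker_tensor x.
Proof.
elim/quotW: x => s; rewrite tensor_piE linear_sum => s0.
have: tensor_rel [seq (p.1, f p.2) | p <- s] [::].
  apply/tensor_piP; rewrite !tensor_piE big_nil big_map -[RHS]s0.
  by apply: eq_bigr => p _; rewrite tensor_mapE.
move=> /section_sum_rel; rewrite /section_sum big_nil subr0 big_map => Ks.
rewrite -[\sum_(p <- s) _](subrK (\sum_(p <- s) pure p.1 (sigma (f p.2)))).
apply: ker_tensorD Ks; rewrite -sumrB.
elim/big_rec: _ => [|p x _]; first exact: ker_tensor0.
apply: ker_tensorD; rewrite -pureNr -pureDr.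
by apply: ker_tensor_pure; rewrite linearB sigmaK subrr.
Qed.
End RightExact.

Section Image.
Context (U V : lmodType R) (f : {linear U -> V}).

Definition range_pred : {pred V} := [pred y | `[< exists x, f x = y >]].

Fact range_closed : submod_closed range_pred.
Proof.
split; first by apply/asboolP; exists 0; rewrite linear0.
move=> a _ _ /asboolP[x <-] /asboolP[y <-]; apply/asboolP.
by exists (a *: x + y); rewrite linearP.
Qed.

Definition range_submod : submodClosed V :=
  HB.pack_for (submodClosed V) range_pred
    (GRing.isSubmodClosed.Build R V range_pred range_closed).

Fact mem_range_submod x : f x \in range_submod. Proof. by apply/asboolP; exists x. Qed.

Fact corestr_linear : linear (fun x => Sub (f x) (mem_range_submod x) : submod range_submod).
Proof.
by move=> a x y; apply: val_inj; rewrite [RHS]linearP; exact: linearP.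
Qed.

Definition corestr : {linear U -> submod range_submod} := mklin corestr_linear.

Lemma corestr_surj y : exists x, corestr x = y.
Proof. by case: y => y /[dup] /asboolP[x fx] yI; exists x; exact: val_inj. Qed.
End Image.

(** Factor [f] as a surjection onto its range followed by an inclusion: flatness cancels the
    inclusion, right exactness handles the surjection. *)
Lemma flat_ker_tensor M U V (f : {linear U -> V}) (x : tensor M U) :
  flat M -> tensor_map (idfun : {linear M -> M}) f x = 0 -> ker_tensor f x.
Proof.
move=> flatM fx0.
pose sigma y := sval (cid (corestr_surj (f := f) y)).
have sigmaK : cancel sigma (corestr f) by move=> y; rewrite /sigma; case: cid.
have [s s0 ->] : ker_tensor (corestr f) x.
  apply: (tensor_right_exact sigmaK).
  pose valf : {linear submod (range_submod f) -> V} := val.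
  apply: (flatM _ _ valf val_inj).
  rewrite linear0 -[RHS]fx0.
  apply: (tensor_ext (f := tensor_map idfun valf
    \o tensor_map idfun (corestr f))) => m u.
  rewrite -[LHS]/(tensor_map _ valf (tensor_map _ (corestr f) _)).
  by rewrite !tensor_mapE.
by exists s => // p /s0 /(congr1 val).
Qed.
End Tensors.

(** * Factoring the inclusion of M_i through a finite free module *)

Section Factorization.
Context (R : comPzRingType) (M : lmodType R).

Section Maps.
Context (n : nat).

Fact combination_linear (t : seq M) :
  linear (fun c : 'rV[R]_n => \sum_(a < n) c 0 a *: t`_a).
Proof.
move=> a u v; rewrite scaler_sumr -big_split; apply: eq_bigr => b _ /=.
by rewrite !mxE scalerDl scalerA.
Qed.

Definition combination t := mklin (combination_linear t).

Fact dot_linear (v : 'rV[R]_n) :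
  linear (fun c : 'rV[R]_n => \sum_(a < n) c 0 a * v 0 a : R^o).
Proof.
move=> a c d; rewrite scaler_sumr -big_split; apply: eq_bigr => b _ /=.
by rewrite !mxE mulrDl -mulrA.
Qed.

Definition dot v := mklin (dot_linear v).

Lemma dotC u v : dot u v = dot v u.
Proof. by apply: eq_bigr => a _; rewrite mulrC. Qed.

Fact dots_linear (r : seq 'rV[R]_n) :
  linear (fun v => \row_(b < size r) (dot v r`_b : R)).
Proof. by move=> a u v; apply/rowP=> b; rewrite !mxE ![dot _ r`_b]dotC linearP. Qed.

(** Its kernel consists of the functionals on [R^n] that vanish on the relations [r]. *)
Definition dots r := mklin (dots_linear r).

Fact scale_coord_linearl (a : 'I_n) (v : 'rV[R]_n) :
  linear (fun m : M => v 0 a *: m).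
Proof. by move=> b m m'; rewrite scalerDr !scalerA mulrC. Qed.

Fact scale_coord_linearr (a : 'I_n) (m : M) :
  linear (fun v : 'rV[R]_n => v 0 a *: m).
Proof. by move=> b u v; rewrite !mxE scalerDl scalerA. Qed.

Definition tensor_coord a :=
  tensor_lift (scale_coord_linearl a) (scale_coord_linearr a).
End Maps.
Arguments combination {n} t.

Lemma combination_submod_span (t : seq M) x :
  x \in submod_span t -> exists c : 'rV_(size t), combination t c = x.
Proof.
move=> /asboolP[c ->]; exists (\row_a c a).
by apply: eq_bigr => a _; rewrite mxE.
Qed.

Lemma tensor_row_delta n (m : M) (v : 'rV[R]_n) :
  pure m v = \sum_(b < n) pure (v 0 b *: m) (delta_mx 0 b).
Proof.
rewrite {1}[v]row_sum_delta -[pure m]/(mklin (pure_linearr m) : _ -> _).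
by rewrite linear_sum; apply: eq_bigr => b _; rewrite pureZl -pureZr.
Qed.

(** Under [M (x) R^n = M^n] the tuple [t] is [sum_a t_a (x) e_a]. As [r] consists of relations on
    [t], [dots r] kills this tensor, so by flatness it comes from [M (x) ker (dots r)]; comparing
    coordinates gives the formula. *)
Lemma flat_relations n (t : seq M) (r : seq 'rV[R]_n) : flat M ->
  (forall v, v \in r -> combination t v = 0) ->
  exists2 s : seq (M * 'rV[R]_n), (forall p, p \in s -> dots r p.2 = 0)
    & forall a : 'I_n, t`_a = \sum_(p <- s) p.2 0 a *: p.1.
Proof.
move=> flatM r0.
have [|s s0 sE] := @flat_ker_tensor _ M _ _ (dots r)
  (\sum_(a < n) pure t`_a (delta_mx 0 a)) flatM.
  rewrite linear_sum.
  under eq_bigr => a _ do rewrite tensor_mapE tensor_row_delta.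
  rewrite exchange_big big1 // => b _.
  (* Coordinate [b] of the image is the relation [r_b] evaluated at [t]. *)
  transitivity (pure (combination t r`_b) (delta_mx 0 b : 'rV[R]_(size r))).
    rewrite -[RHS]/(mklin (pure_linearl _) _) [RHS]linear_sum.
    apply: eq_bigr => a _ /=; congr (pure (_ *: _) _).
    rewrite mxE /= (bigD1 a) //= big1 => [|c ca].
      by rewrite addr0 !mxE !eqxx mulr1.
    by rewrite !mxE (negbTE ca) mulr0.
  by rewrite r0 ?mem_nth // -(scale0r 0) pureZl scale0r.
exists s => // a.
have /(congr1 (tensor_coord a)) := sE; rewrite !linear_sum.
under eq_bigr do rewrite tensor_liftE.
under [RHS]eq_bigr do rewrite tensor_liftE.
move=> <-; rewrite (bigD1 a) //= big1 => [|c ca].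
  by rewrite addr0 !mxE !eqxx scale1r.
by rewrite !mxE eq_sym (negbTE ca) scale0r.
Qed.

(** The functional [dot v] vanishes on all relations between the generators [t], so it descends from
    the free module to [M_i]. *)
Lemma dual_of_row (i : fgsub M) (t : seq M) (r : seq 'rV[R]_(size t)) v :
  i =i submod_span t ->
  (forall c, combination t c = 0 -> c \in submod_span r) ->
  dots r v = 0 ->
  exists phi : dual_mod (submod i),
    forall c y, combination t c = val y -> phi y = dot v c.
Proof.
move=> iE r_gen rv0.
have dot0 c : combination t c = 0 -> dot v c = 0.
  move=> /r_gen/asboolP[d ->]; rewrite linear_sum big1 // => b _.
  rewrite linearZ; have /rowP/(_ b) := rv0; rewrite !mxE => ->; exact: mulr0.
have dot_wd c d : combination t c = combination t d -> dot v c = dot v d.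
  move=> cd; apply/eqP; rewrite -subr_eq0 -linearB dot0 //.
  by rewrite linearB cd subrr.
have c_ex (y : submod i) : exists c : 'rV_(size t), combination t c = val y.
  by apply: combination_submod_span; rewrite -iE; exact: valP.
pose c y := sval (cid (c_ex y)).
have cE y : combination t (c y) = val y by rewrite /c; case: cid.
have phi_lin : linear (fun y => dot v (c y)).
  move=> a x y; rewrite -linearP; apply: dot_wd.
  by rewrite [RHS]linearP !cE; exact: (linearP (val : {linear submod i -> M})).
exists (mklin phi_lin) => d y dE /=.
by apply: dot_wd; rewrite cE.
Qed.

(* That is, the inclusion of [M_i] in [M] factors through a finite free module. *)
Lemma flat_factor (i : fgsub M) : noetherian R -> flat M ->
  exists s : seq (M * dual_mod (submod i)),
    forall y : submod i, val y = \sum_(p <- s) (p.2 y : R) *: p.1.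
Proof.
move=> noethR flatM; have [t iE] := fgsubP i.
have [|r rE] := @noetherian_row _ noethR (size t)
  [pred c | combination t c == 0].
  split=> [|a x y]; first by rewrite inE linear0.
  by rewrite !inE linearP => /eqP-> /eqP->; rewrite scaler0 addr0.
have [|s s0 sE] := @flat_relations _ t r flatM.
  by move=> v /mem_submod_span; rewrite -rE => /eqP.
(* Rows outside the kernel of [dots r] get the default functional [0]; the rows occurring in [s] all
   lie in the kernel. *)
have /choice[phi phiE] v : exists phi : dual_mod (submod i), dots r v = 0 ->
    forall c y, combination t c = val y -> phi y = dot v c.
  have [v0|nv0] := EM (dots r v = 0); last by exists 0.
  have [|phi phiE] := dual_of_row iE _ v0; last by exists phi.
  by move=> c c0; rewrite -rE inE c0.
exists [seq (p.1, phi p.2) | p <- s] => y; rewrite big_map.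
have [|c cE] := @combination_submod_span t (val y).
  by rewrite -iE; exact: valP.
rewrite -cE /= (eq_bigr _ (fun a _ => congr1 _ (sE a))).
under eq_bigr do rewrite scaler_sumr.
rewrite exchange_big; apply: eq_big_seq => p ps /=.
rewrite (phiE _ (s0 _ ps) c) // scaler_suml.
by apply: eq_bigr => a _; rewrite scalerA.
Qed.
End Factorization.

(** * Bijectivity of the comparison morphism for flat M *)

Section Comparison.
Context (R : comPzRingType) (M N : lmodType R).

Lemma tensor_colim_surj (x : tensor M N) :
  exists (i : fgsubs M) (x' : tensor (submod i) N), tensor_colim_at N i x' = x.
Proof.
rewrite -[x]to_tensor_colimK; elim/dlimW: (to_tensor_colim M N x) => i x'.
by exists i, x'; rewrite [RHS](dlim_liftE (@tensor_colim_at_tr _ _ N)).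
Qed.

Section Factored.
Context (i : fgsubs M) (s : seq (M * dual_mod (submod i))).
Hypothesis sE : forall y : submod i, val y = \sum_(p <- s) (p.2 y : R) *: p.1.

Lemma factored_colim_at (x : tensor (submod i) N) :
  tensor_colim_at N i x = \sum_(p <- s) pure p.1 (nat_map N i x p.2).
Proof.
elim/tensor_ind: x => [|m n x IHx].
  rewrite !linear0 big1 // => p _.
  by rewrite -(scale0r 0) pureZr scale0r.
rewrite !linearD IHx; under [RHS]eq_bigr do rewrite pureDr.
rewrite big_split; congr (_ + _); rewrite tensor_colim_atE sE.
rewrite -[LHS]/(mklin (pure_linearl n) _) linear_sum.
by apply: eq_bigr => p _; rewrite nat_mapE pureZr -pureZl.
Qed.

(** At a stage [j] containing [M_i] and all [m_k], the left side sends [w] to [sum_k w(m_k) u(phi_k)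
    = u(sum_k w(m_k) phi_k)], and the argument of [u] is the restriction of [w] to [M_i]. *)
Lemma factored_comparison (u : {linear dual_mod (submod i) -> N}) :
  comparison M N (\sum_(p <- s) pure p.1 (u p.2)) = dlim_in (homdual_system M N) i u.
Proof.
have [j [ij sj]] := fgsub_directed i (fg_span (map fst s)).
have sPj p : p \in s -> p.1 \in j.
  by move=> ps; apply/sj/mem_submod_span/map_f.
(* The default [0] is never taken on the [m_k], which all lie in [j]. *)
pose lift (m : M) : submod j := insubd 0 m.
have liftE p : p \in s -> val (lift p.1) = p.1.
  by move=> /sPj pj; rewrite /lift insubdK.
have ->: \sum_(p <- s) pure p.1 (u p.2) =
    tensor_colim_at N j (\sum_(p <- s) pure (lift p.1) (u p.2)).
  rewrite linear_sum; apply: eq_big_seq => p ps.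
  by rewrite tensor_colim_atE liftE.
rewrite comparisonE -[RHS](dlim_in_tr (F := homdual_system M N) (ij : dp_le i j)).
congr (dlim_in (homdual_system M N) j _); apply: linear_ext => w.
rewrite linear_sum hom_sumE.
transitivity (\sum_(p <- s) u ((w (lift p.1) : R) *: p.2)).
  by apply: eq_bigr => p _; rewrite nat_mapE linearZ.
rewrite -linear_sum; congr (u _); apply: linear_ext => y.
rewrite hom_sumE -[RHS]/(w (incl ij y)).
have ->: incl ij y = \sum_(p <- s) (p.2 y : R) *: lift p.1.
  apply: val_inj; rewrite [RHS](linear_sum (val : {linear submod j -> M})) /= sE.
  apply: eq_big_seq => p ps; rewrite -[in LHS](liftE p ps).
  exact/esym/(linearZZ (val : {linear submod j -> M})).
by rewrite linear_sum; apply: eq_bigr => p _; rewrite linearZ; exact: mulrC.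
Qed.
End Factored.

Lemma flat_comparison_bijective :
  noetherian R -> flat M -> bijective (@comparison R M N).
Proof.
move=> noethR flatM; apply: inj_surj_bijective.
  apply: linear_inj_ker => x; have [i [{}x <-]] := tensor_colim_surj x.
  rewrite comparisonE -(linear0 (dlim_in (homdual_system M N) i)).
  move=> /dlim_inP[j [ij [ij']]]; rewrite linear0 -nat_map_tr => x0.
  rewrite -(tensor_colim_at_tr ij).
  (* The factorization is taken at [j], the stage where the image under [nat_map] has become
     zero. *)
  have [s sE] := flat_factor j noethR flatM.
  rewrite (factored_colim_at sE) x0 big1 // => p _.
  by rewrite -(scale0r 0) pureZr scale0r.
elim/dlimW=> i u; have [s sE] := flat_factor i noethR flatM.
by exists (\sum_(p <- s) pure p.1 (u p.2)); rewrite (factored_comparison sE).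
Qed.
End Comparison.

(** * Naturality in N and the converse *)

Section Naturality.
Context (R : comPzRingType) (M N N' : lmodType R) (g : {linear N -> N'}).

Lemma nat_map_natural (i : fgsubs M) (x : tensor (submod i) N) w :
  nat_map N' i (tensor_map idfun g x) w = g (nat_map N i x w).
Proof.
elim/tensor_ind: x => [|m n x IHx]; first by rewrite !linear0 hom0E.
by rewrite !linearD homDE IHx tensor_mapE !nat_mapE linearZ.
Qed.

Lemma tensor_colim_at_natural (i : fgsubs M) (x : tensor (submod i) N) :
  tensor_map idfun g (tensor_colim_at N i x) =
  tensor_colim_at N' i (tensor_map idfun g x).
Proof.
elim/tensor_ind: x => [|m n x IHx]; first by rewrite !linear0.
by rewrite !linearD IHx !(tensor_colim_atE, tensor_mapE).
Qed.

(** If [g] kills a tensor, its image in [Hom(M_j^*, N')] is zero for some [j]. This image is [g]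
    composed with the image in [Hom(M_j^*, N)], which is therefore zero as well, and injectivity of
    [comparison] for [N] concludes. *)
Lemma comparison_reflects_injective :
  injective g -> injective (@comparison R M N) ->
  injective (tensor_map (idfun : {linear M -> M}) g).
Proof.
move=> g_inj cN_inj; apply: linear_inj_ker => x.
have [i [{}x <-]] := tensor_colim_surj x.
rewrite tensor_colim_at_natural => x0; apply: cN_inj; rewrite linear0.
have := congr1 (@comparison R M N') x0; rewrite linear0 !comparisonE.
rewrite -(linear0 (dlim_in (homdual_system M N') i)).
move=> /dlim_inP[j [ij [ij' e]]].
rewrite -(linear0 (dlim_in (homdual_system M N) i)); apply/dlim_inP.
exists j, ij, ij'; apply: linear_ext => w; apply: g_inj.
have := congr1 (fun u : {linear dual_mod (submod j) -> N'} => u w) e.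
by rewrite /= nat_map_natural linear0.
Qed.
End Naturality.

Theorem corollary3p8 (R : comPzRingType) (M : lmodType R) :
  noetherian R ->
  (flat M <-> forall N : lmodType R, bijective (@comparison R M N)).
Proof.
move=> noethR; split=> [flatM N|bijM N N' g g_inj].
  exact: flat_comparison_bijective.
exact: comparison_reflects_injective g_inj (bij_inj (bijM N)).
Qed.
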